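(* Let $\epsilon,\delta\in(0,1)$. Let $D$ be an i.i.d. data set drawn from a continuous distribution $P$ on $\mathbb R^m$, partitioned into two sets $D_1=\{\xi^1_i\}_{i=1,\ldots,n_1}$ and $D_2=\{\xi^2_i\}_{i=1,\ldots,n_2}$. Suppose $n_2\ge \log\delta/\log(1-\epsilon)$. Let $t:\mathbb R^m\to\mathbb R$ be a map constructed from $D_1$ (only) such that $t(\xi)$, with $\xi$ distributed according to $P$, is a continuous random variable. Let $$i^*=\min\left\{r:\ \sum_{k=0}^{r-1}\binom{n_2}{k}(1-\epsilon)^k\epsilon^{n_2-k}\ge 1-\delta,\ 1\le r\le n_2\right\},$$ let $t(\xi^2_{(1)})<t(\xi^2_{(2)})<\cdots<t(\xi^2_{(n_2)})$ be the ranked values of $\{t(\xi^2_i)\}_{i=1,\ldots,n_2}$, and set $$\mathcal U=\mathcal U(D)=\{\xi\in\mathbb R^m:\ t(\xi)\le s\},\qquad s=t(\xi^2_{(i^* )}).$$ Then $$\mathbb P_D\big(P(\xi\in\mathcal U(D))\ge 1-\epsilon\big)\ge 1-\delta .$$ Consequently, an optimal solution obtained from the robust optimization problem $$\text{minimize } f(x)\ \text{ subject to }\ g(x;\xi)\in\mathcal A\ \ \forall\,\xi\in\mathcal U$$ with this $\mathcal U$ is feasible, with confidence $1-\delta$, for the chance-constrained program $$\text{minimize } f(x)\ \text{ subject to }\ P(g(x;\xi)\in\mathcal A)\ge 1-\epsilon .$$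
   Context: $x\in\mathbb R^d$ is the decision vector, $f(x)\in\mathbb R$ the objective, $\xi\in\mathbb R^m$ a random vector with distribution $P$, $g:\mathbb R^d\times\mathbb R^m\to\Omega$ for some space $\Omega$, and $\mathcal A\subset\Omega$. $\mathbb P_D(\cdot)$ denotes probability with respect to the data $D$; inside it, $P(\xi\in\mathcal U(D))$ is the probability with respect to a fresh $\xi\sim P$ with the data held fixed. ''Feasible with confidence $1-\delta$'' means that the probability, with respect to the data $D$, that the obtained (data-dependent) solution $\hat x$ satisfies $P(g(\hat x;\xi)\in\mathcal A)\ge 1-\epsilon$ is at least $1-\delta$. The sizes $n_1,n_2$ of the partition are fixed, and a continuous random variable is one with a continuous distribution function. *)

(* Defs.v *)
From HB Require Import structures.
From mathcomp Require Import all_boot all_order all_algebra.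
From mathcomp Require Import all_classical all_reals all_analysis.

Set Implicit Arguments.
Unset Strict Implicit.
Unset Printing Implicit Defensive.

Import Order.TTheory GRing.Theory Num.Theory.
Import numFieldNormedType.Exports.

Local Open Scope classical_set_scope.
Local Open Scope ring_scope.

(* R^m is [m.-tuple R]: the library equips it with the sigma-algebra generated
   by the coordinates, i.e. the Borel sigma-algebra. *)

(* Tuples carry no topology in the library, so the joint distribution function
   takes its argument in 'rV[R]_m, whose topology is that of R^m. *)
Definition joint_cdf (R : realType) (m : nat)
    (P : probability (m.-tuple R) R) (a : 'rV[R]_m) : \bar R :=
  P [set y | forall i : 'I_m, tnth y i <= a ord0 i].

Definition continuous_distribution (R : realType) (m : nat)
    (P : probability (m.-tuple R) R) : Prop :=
  continuous (joint_cdf P).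

Definition mutually_independent (R : realType) (d d' : measure_display)
    (W : measurableType d) (T : measurableType d') (Q : probability W R)
    (I : finType) (X : I -> {RV Q >-> T}) : Prop :=
  forall (J : {set I}) (B : I -> set T),
    (forall i, i \in J -> measurable (B i)) ->
    Q (\bigcap_(i in [set` J]) (X i @^-1` B i))
      = (\prod_(i in J) Q (X i @^-1` B i))%E.

Definition iid (R : realType) (d d' : measure_display)
    (W : measurableType d) (T : measurableType d') (Q : probability W R)
    (P : probability T R) (I : finType) (X : I -> {RV Q >-> T}) : Prop :=
  mutually_independent X /\
  forall i (B : set T), measurable B -> distribution Q (X i) B = P B.

Section data.
Context (R : realType) (d : measure_display) (W : measurableType d).
Context (Q : probability W R) (m n1 n2 : nat).

(* The sum type indexes the whole data set D: [inl] for D_1, [inr] for D_2. *)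
Definition data1 (X : 'I_n1 + 'I_n2 -> {RV Q >-> m.-tuple R}) (w : W) :
  n1.-tuple (m.-tuple R) := [tuple X (inl i) w | i < n1].

Definition data2 (X : 'I_n1 + 'I_n2 -> {RV Q >-> m.-tuple R}) (w : W) :
  n2.-tuple (m.-tuple R) := [tuple X (inr i) w | i < n2].

End data.

(* The head of the increasing list of admissible ranks is their minimum. The
   default 0 occurs only when no rank is admissible, which is impossible for
   ln delta / ln (1 - eps) <= n2. *)
Definition istar (R : realType) (eps delta : R) (n2 : nat) : nat :=
  head 0%N [seq r <- iota 1 n2 |
    1 - delta <=
      \sum_(k < r) 'C(n2, k)%:R * (1 - eps) ^+ k * eps ^+ (n2 - k)].

(* Ranks count from 1. *)
Definition order_statistic (R : realType) (s : seq R) (r : nat) : R :=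
  nth 0 (sort <=%R s) r.-1.

Definition uncertainty_set (R : realType) (m n1 n2 : nat) (eps delta : R)
    (t : n1.-tuple (m.-tuple R) -> m.-tuple R -> R)
    (D1 : n1.-tuple (m.-tuple R)) (D2 : n2.-tuple (m.-tuple R)) :
    set (m.-tuple R) :=
  [set y | t D1 y <=
     order_statistic [seq t D1 z | z <- D2] (istar eps delta n2)].

Section optimization.
Context (R : realType) (d m : nat) (V : Type).
Implicit Types (f : d.-tuple R -> R) (g : d.-tuple R -> m.-tuple R -> V).
Implicit Types (A : set V) (U : set (m.-tuple R)) (x : d.-tuple R).

Definition robust_feasible g A U x : Prop := forall y, U y -> A (g x y).

Definition robust_optimal f g A U x : Prop :=
  robust_feasible g A U x /\
  forall x', robust_feasible g A U x' -> f x <= f x'.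

Definition chance_feasible (P : probability (m.-tuple R) R) (eps : R) g A x :
    Prop :=
  ((1 - eps)%:E <= P [set y | A (g x y)])%E.

End optimization.

(* Main.v *)
Require Import Defs.
From HB Require Import structures.
From mathcomp Require Import all_boot all_order all_algebra.
From mathcomp Require Import all_classical all_reals all_analysis.
From mathcomp Require Import measurable_realfun.

(** Call a point low for a given first data set when the distribution function
    of its score is below [1 - eps] there.  The uncertainty set is a sublevel
    set of the score, so its probability is the distribution function of the
    score at the threshold, and it is smaller than [1 - eps] exactly when the
    [istar]-th smallest calibration score is low, that is when at least [istar]
    of the [n2] calibration points are low
    ([order_statistic_count], [uncertainty_set_coverage]).

    Given the first data set, the score is a continuous random variable, so a
    new point is low with probability exactly [1 - eps] ([probability_cdf_lt]).
    This value does not depend on the first data set, hence the number of low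
    calibration points is binomial with parameters [n2] and [1 - eps], also
    unconditionally.  The event that it is less than [istar] therefore has as
    probability the binomial sum that defines [istar], which is at least
    [1 - delta]; the lower bound on [n2] ensures that an admissible rank exists
    ([istarP]).

    The unconditional statement is obtained without conditional expectations.
    An observation is independent of the sigma-algebra generated by all the
    others ([mutually_independent_sigma_off]), so the joint law of that
    observation and any function of the others is a product measure; integrating
    over sections shows that the event that the [k]-th calibration point is low
    multiplies the probability of any event about the previous points by
    [1 - eps] ([probability_fresh_section]), and Pascal's recursion gives the
    binomial law ([count_binomial]).

    The claim on robust optimization follows because almost surely the solution
    satisfies its constraint on the whole uncertainty set, so the probability of
    satisfying the constraint is at least that of the uncertainty set. *)

Set Implicit Arguments.
Unset Strict Implicit.
Unset Printing Implicit Defensive.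

Import Order.TTheory GRing.Theory Num.Theory.
Import numFieldNormedType.Exports.

Local Open Scope classical_set_scope.
Local Open Scope ring_scope.

(** * Scores below a quantile *)

Lemma measurable_sublevel (d : measure_display) (T : measurableType d)
    (R : realType) (P : probability T R) (X : {RV P >-> R}) (c : R) :
  measurable [set y | X y <= c].
Proof.
have := measurable_funPT X measurableT _ (measurable_itv `]-oo, c]).
by rewrite setTI; congr measurable; apply/seteqP; split => y /=; rewrite in_itv.
Qed.

Lemma cdf_sublevel (d : measure_display) (T : measurableType d)
    (R : realType) (P : probability T R) (X : {RV P >-> R}) (c : R) :
  cdf X c = P [set y | X y <= c].
Proof. by congr (P _); apply/seteqP; split => y /=; rewrite in_itv. Qed.

(** The intermediate value theorem between the limits 0 and 1 of a
    distribution function. *)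
Lemma cdf_onto (d : measure_display) (T : measurableType d) (R : realType)
    (P : probability T R) (X : {RV P >-> R}) (v : R) :
  continuous (cdf X) -> 0 < v < 1 -> exists c, cdf X c = v%:E.
Proof.
move=> cX /andP[v0 v1].
have cdfE r : (fine (cdf X r))%:E = cdf X r by rewrite fineK// fin_num_measure.
have fX (F : set_system R) (FF : Filter F) l :
    cdf X @ F --> l%:E -> (fine \o cdf X) @ F --> l by exact: fine_cvg.
have [a av] : exists a, fine (cdf X a) < v.
  have /fX/cvgr_lt/(_ v v0) := cvg_cdfNy0 X.
  by move=> /filter_ex[a /= ?]; exists a.
have [b vb] : exists b, v < fine (cdf X b).
  have /fX/cvgr_gt/(_ v v1) := cvg_cdfy1 X.
  by move=> /filter_ex[b /= ?]; exists b.
have ab : a <= b.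
  rewrite leNgt; apply/negP => /ltW/(cdf_nondecreasing X).
  rewrite -(cdfE a) -(cdfE b) lee_fin; apply/negP.
  by rewrite -ltNge (lt_trans av).
have cf : continuous (fine \o cdf X).
  by move=> x; apply: fX; rewrite cdfE; exact: cX.
have [|c _ cv] := @IVT R (fine \o cdf X) a b v ab (continuous_subspaceT cf).
  rewrite /= minElt maxElt (lt_trans av vb) (ltW av) (ltW vb)//.
by exists c; rewrite -cdfE -cv.
Qed.

(** The probability integral transform, at the only level at which it is needed:
    the event is squeezed between sublevel sets of [X].  A point where the
    distribution function equals [v] bounds it from above; points where it
    equals a level below [v] bound it from below. *)
Lemma probability_cdf_lt (d : measure_display) (T : measurableType d)
    (R : realType) (P : probability T R) (X : {RV P >-> R}) (v : R) :
  continuous (cdf X) -> 0 < v < 1 ->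
  P [set y | (cdf X (X y) < v%:E)%E] = v%:E.
Proof.
move=> cX v01; have /andP[v0 v1] := v01.
have mA : measurable [set y | (cdf X (X y) < v%:E)%E].
  have : measurable_fun setT ((cdf X : R -> \bar R) \o X).
    by apply: measurableT_comp => //; exact: cdf_measurable.
  move=> /(_ measurableT _ (emeasurable_itv `]-oo, v%:E[)).
  by rewrite setTI; congr measurable; apply/seteqP; split => y /=; rewrite in_itv.
have mB := measurable_sublevel X.
apply/le_anti/andP; split.
- have [c cv] := cdf_onto cX v01.
  rewrite -[leRHS]cv cdf_sublevel; apply: le_measure; rewrite ?inE// => y /= yv.
  rewrite leNgt; apply/negP => /ltW/(cdf_nondecreasing X).
  by rewrite cv leNgt yv.
- apply/lee_subgt0Pr => e e0.
  (* The second argument keeps the level positive when e is large. *)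
  pose v' := Num.max (v - e) (v / 2).
  have v'v : v' < v.
    by rewrite gt_max ltrBlDr ltrDl e0 ltr_pdivrMr// ltr_pMr// ltr1n.
  have v'01 : 0 < v' < 1.
    by rewrite (lt_trans v'v v1) lt_max divr_gt0// orbT.
  have [c cv] := cdf_onto cX v'01.
  apply: (@le_trans _ _ v'%:E); first by rewrite -EFinB lee_fin le_max lexx.
  rewrite -[leLHS]cv cdf_sublevel; apply: le_measure; rewrite ?inE// => y /= yc.
  by rewrite (le_lt_trans (cdf_nondecreasing X yc))// cv lte_fin.
Qed.

(** * Ranks *)

(** In the sorted sequence the entries that satisfy a downward closed predicate
    come first, so the [r]-th one satisfies it iff at least [r] entries do.  The
    random order statistic is thereby replaced by a sum of indicators. *)
Lemma order_statistic_count (R : realType) (s : seq R) (r : nat) (p : pred R) :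
  (forall x y, x <= y -> p y -> p x) -> (0 < r <= size s)%N ->
  p (order_statistic s r) = (r <= count p s)%N.
Proof.
move=> pdown /andP[r0 rs]; rewrite /order_statistic.
rewrite -(count_sort <=%R p s).
set s' := sort _ s.
have ss : sorted <=%R s' by exact/sort_sorted/le_total.
have rs' : (r <= size s')%N by rewrite size_sort.
have nthle i j : (i <= j)%N -> (j < size s')%N -> s'`_i <= s'`_j.
  move=> ij js; apply: (sorted_leq_nth le_trans lexx) => //.
  by rewrite inE (leq_ltn_trans ij).
have r1 : (r.-1 < size s')%N by rewrite prednK.
rewrite -[in count p s'](cat_take_drop r s') count_cat.
apply/idP/idP => [pr|].
- rewrite (leq_trans _ (leq_addr _ _))//.
  suff /eqP -> : count p (take r s') == size (take r s') by rewrite size_takel.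
  rewrite -all_count; apply/(all_nthP 0) => i; rewrite size_takel// => ir.
  by rewrite nth_take//; apply: pdown pr; apply: nthle => //; rewrite -ltnS prednK.
- apply: contraTT => npr; rewrite -ltnNge.
  have -> : count p (drop r s') = 0%N.
    apply/eqP; rewrite -leqn0 leqNgt -has_count.
    apply/negP => /(has_nthP 0)[i]; rewrite size_drop nth_drop ltn_subRL => irs.
    move=> pi; move: npr; rewrite (pdown _ _ _ pi)// nthle//.
    by rewrite (leq_trans (leq_pred _))// leq_addr.
  rewrite addn0 -[ltnRHS](size_takel rs') ltn_neqAle count_size andbT.
  rewrite -all_count; apply: contra npr => /(all_nthP 0)/(_ r.-1).
  by rewrite size_takel// nth_take prednK//; apply.
Qed.

(** The rank [n] is always admissible: its binomial sum lacks only the last term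
    [(1 - eps) ^+ n], and the lower bound on [n] says exactly that this term is
    at most [delta]. *)
Lemma istarP (R : realType) (eps delta : R) (n : nat) :
  0 < eps < 1 -> 0 < delta < 1 -> ln delta / ln (1 - eps) <= n%:R ->
  (0 < istar eps delta n <= n)%N /\
  1 - delta <= \sum_(k < istar eps delta n)
     'C(n, k)%:R * (1 - eps) ^+ k * eps ^+ (n - k).
Proof.
move=> /andP[e0 e1] /andP[d0 d1] nlarge.
rewrite /istar.
set a := (X in seq.filter X _); set s := seq.filter a _.
suff : head 0%N s \in s by rewrite mem_filter mem_iota add1n ltnS andbC => /andP.
suff : n \in s by case: s => // x s' _; rewrite mem_head.
have q0 : 0 < 1 - eps by rewrite subr_gt0.
have lnq : ln (1 - eps) < 0 by rewrite ln_lt0// q0 ltrBlDr ltrDl.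
have n0 : (0 < n)%N.
  rewrite -(ltr0n R); apply: lt_le_trans nlarge.
  by rewrite ltr_ndivlMr// mul0r ln_lt0// d0.
rewrite mem_filter mem_iota add1n ltnS leqnn n0 !andbT /a.
have -> : \sum_(k < n) 'C(n, k)%:R * (1 - eps) ^+ k * eps ^+ (n - k)
    = 1 - (1 - eps) ^+ n.
  apply/eqP; rewrite -subr_eq0 opprB addrA subr_eq0; apply/eqP.
  rewrite -[RHS](expr1n R n) -[X in _ = X ^+ _](subrKC eps) [RHS]exprDn.
  rewrite big_ord_recr/= subnn expr0 mul1r binn mulr1n; congr (_ + _).
  by apply: eq_bigr => i _; rewrite -[RHS]mulr_natl -mulrA (mulrC (eps ^+ _)).
rewrite lerD2l lerN2 -ler_ln ?posrE ?exprn_gt0// lnXn//.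
by move: nlarge; rewrite ler_ndivrMr// mulr_natl.
Qed.

(** * Independence of one observation from all the others *)

(** A pi-system generating the sigma-algebra of all observations but the [k]-th:
    full cylinders whose [k]-th face is trivial. *)
Definition cylinders_off (W T : Type) (S : set (set T)) (I : Type)
    (X : I -> W -> T) (k : I) : set (set W) :=
  [set C | exists B : I -> set T,
    [/\ forall i, S (B i), B k = setT & C = \bigcap_i (X i @^-1` B i)]].

Lemma cylinders_off_measurable (d d' : measure_display)
    (W : measurableType d) (T : measurableType d') (I : finType)
    (X : I -> {mfun W >-> T}) (k : I) :
  <<s cylinders_off measurable X k >> `<=` @measurable _ W.
Proof.
apply: smallest_sub; first exact: sigma_algebra_measurable.
move=> _ [B [mB _ ->]]; apply: fin_bigcap_measurable => //.
move=> i _; rewrite -[X in measurable X]setTI; exact: measurable_funPT.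
Qed.

Lemma measurable_fun_off (d d' : measure_display)
    (W : measurableType d) (T : measurableType d') (I : finType)
    (X : I -> W -> T) (k i : I) : i != k ->
  measurable_fun [set: g_sigma_algebraType (cylinders_off measurable X k)] (X i).
Proof.
move=> ik _ A mA; rewrite setTI; apply: sub_sigma_algebra.
exists (fun j => if j == i then A else setT); split.
- by move=> j; case: ifP.
- by rewrite eq_sym (negbTE ik).
- apply/seteqP; split => [w Aw j _ /=|w /(_ i Logic.I)/=]; last by rewrite eqxx.
  by case: eqP => // ->.
Qed.

(** Mutual independence only speaks of cylinders; Dynkin's theorem extends it to
    every event determined by the observations other than the [k]-th. *)
Lemma mutually_independent_sigma_off (R : realType) (d d' : measure_display)
    (W : measurableType d) (T : measurableType d') (Q : probability W R)
    (I : finType) (X : I -> {RV Q >-> T}) (k : I) (C : set W) (B : set T) :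
  mutually_independent X ->
  <<s cylinders_off measurable X k >> C -> measurable B ->
  Q (C `&` X k @^-1` B) = (Q C * Q (X k @^-1` B))%E.
Proof.
move=> indX GC mB.
have mXB i D : measurable D -> measurable (X i @^-1` D).
  by move=> mD; rewrite -[X in measurable X]setTI; exact: measurable_funPT.
have prodX (D : I -> set T) : (forall i, measurable (D i)) ->
    Q (\bigcap_i (X i @^-1` D i)) = (\prod_i Q (X i @^-1` D i))%E.
  move=> mD; have := indX [set: I]%SET D (fun i _ => mD i).
  rewrite (_ : [set` [set: I]%SET] = setT).
    by move=> ->; apply: eq_bigl => i; rewrite inE.
  by apply/seteqP; split => // i _ /=; rewrite inE.
set G := cylinders_off _ _ _ in GC *.
have GW : <<s G >> `<=` @measurable _ W by exact: cylinders_off_measurable.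
have mY : measurable (X k @^-1` B) by exact: mXB.
have Qfin (A : set W) : measurable A -> Q A \is a fin_num.
  by move=> mA; exact: fin_num_measure.
move: C GC.
apply: (@dynkin_induction _ (g_sigma_algebraType G)) => //.
- move=> _ _ [D [mD Dk ->]] [E [mE Ek ->]].
  exists (fun i => D i `&` E i); split.
  + by move=> i; exact: measurableI.
  + by rewrite Dk Ek setTI.
  + by rewrite -bigcapI.
- by rewrite setTI probability_setT mul1e.
- move=> _ [D [mD Dk ->]].
  pose D' i := if i == k then B else D i.
  have -> : \bigcap_i (X i @^-1` D i) `&` X k @^-1` B =
      \bigcap_i (X i @^-1` D' i).
    apply/seteqP; split => [w [Dw Bw] i _|w Dw].
      by rewrite /D'; case: eqP => [->//|_]; exact: Dw.
    split; last by have := Dw k Logic.I; rewrite /D' eqxx.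
    move=> i _; have := Dw i Logic.I; rewrite /D'; case: eqP => // -> _.
    by rewrite Dk.
  rewrite !prodX// => [|i]; last by rewrite /D'; case: ifP.
  rewrite (bigD1 k)//= [in RHS](bigD1 k)//= /D' eqxx Dk preimage_setT.
  rewrite probability_setT mul1e muleC; congr (_ * _)%E.
  by apply: eq_bigr => i /negbTE ->.
- move=> S GS QS; have mS := GW _ GS.
  rewrite setIC -setDE measureD//; last by rewrite -ge0_fin_numE// Qfin.
  rewrite probability_setC// muleBl ?Qfin// mul1e setIC; congr (_ - _)%E.
  exact: QS.
- move=> F GF tF QF; have mF n := GW _ (GF n).
  rewrite setI_bigcupl.
  rewrite (measure_bigcup Q)//; last 2 first.
  - by move=> n _; apply: measurableI.
  - exact: trivIset_setIr.
  rewrite (measure_bigcup Q)//.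
  rewrite muleC -[X in (X * _)%E](fineK (Qfin _ mY)) -nneseriesZl//.
  by apply: eq_eseriesr => n _; rewrite fineK ?Qfin// muleC; exact: QF.
Qed.

(** Independence makes the law of the pair a product measure, whose value on [S]
    is an integral of sections: this is conditioning on [Z] without
    conditional expectations. *)
Lemma probability_pair_section (R : realType) (dW d1 d2 : measure_display)
    (W : measurableType dW) (T1 : measurableType d1) (T2 : measurableType d2)
    (Q : probability W R) (P : probability T2 R) (Z : {RV Q >-> T1})
    (Y : {RV Q >-> T2}) (S : set (T1 * T2)) :
  (forall A B, measurable A -> measurable B ->
     Q (Z @^-1` A `&` Y @^-1` B) = (Q (Z @^-1` A) * P B)%E) ->
  measurable S ->
  Q [set w | S (Z w, Y w)] = (\int[Q]_w P (xsection S (Z w)))%E.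
Proof.
move=> indZY mS.
have mZY : measurable_fun [set: W] (fun w => (Z w, Y w)).
  exact: measurable_fun_pair.
pose ZY : {RV Q >-> (T1 * T2)%type} := mfun_Sub (mem_set mZY).
have mPS : measurable_fun [set: T1] (fun z => P (xsection S z)).
  exact: measurable_fun_xsection.
rewrite -(ge0_integral_distribution Z mPS)//.
rewrite [RHS](_ : _ = distribution Q ZY S)//.
apply: (@product_measure_unique _ _ _ _ _ (distribution Q Z) P
  (distribution Q ZY)) => //.
Qed.

(** If, whatever the past [Z], a fresh observation falls into the section of [S]
    with the same probability [q], then falling into it is independent of the
    whole past [G], although [S] itself is selected by the past. *)
Lemma probability_fresh_section (R : realType) (dW d1 d2 : measure_display)
    (W : measurableType dW) (T1 : measurableType d1) (T2 : measurableType d2)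
    (Q : probability W R) (P : probability T2 R) (Y : {RV Q >-> T2})
    (G : set (set W)) (C : set W) (Z : W -> T1) (S : set (T1 * T2)) (q : R) :
  <<s G >> `<=` measurable ->
  (forall A B, <<s G >> A -> measurable B ->
     Q (A `&` Y @^-1` B) = (Q A * P B)%E) ->
  measurable_fun [set: g_sigma_algebraType G] Z -> <<s G >> C ->
  measurable S -> {ae Q, forall w, P (xsection S (Z w)) = q%:E} ->
  Q (C `&` [set w | S (Z w, Y w)]) = (q%:E * Q C)%E.
Proof.
move=> GW indY mZ GC mS PSq.
(* Recording the occurrence of C next to Z turns the restriction to C into a
   condition on the first component of one pair. *)
pose f w : bool * T1 := (w \in C, Z w).
have mf : measurable_fun [set: g_sigma_algebraType G] f.
  apply: measurable_fun_pair => //; apply: (measurable_fun_bool true).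
  rewrite setTI (_ : _ @^-1` _ = C)//.
  by apply/seteqP; split => w /= => [/set_mem|/mem_set].
have mfW : measurable_fun [set: W] f.
  by move=> _ A mA; apply: GW; exact: mf.
pose F : {RV Q >-> (bool * T1)%type} := mfun_Sub (mem_set mfW).
pose S' : set ((bool * T1) * T2) := [set u | u.1.1 && `[< S (u.1.2, u.2) >]].
have mS' : measurable S'.
  have -> : S' = (fun u : (bool * T1) * T2 => u.1.1) @^-1` [set true] `&`
      (fun u : (bool * T1) * T2 => (u.1.2, u.2)) @^-1` S.
    by apply/seteqP; split => u /= => [/andP[? /asboolP]//|[? ?]];
      apply/andP; split => //; apply/asboolP.
  apply: measurableI.
  - rewrite -[X in measurable X]setTI.
    exact: (measurableT_comp measurable_fst measurable_fst).
  - rewrite -[X in measurable X]setTI; apply: measurable_fun_pair => //.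
    exact: (measurableT_comp measurable_snd measurable_fst).
have secS' w : xsection S' (F w) = if w \in C then xsection S (Z w) else set0.
  apply/seteqP; split => y /=.
    by move=> /set_mem/= /andP[/= wC /asboolP Sy]; rewrite wC; exact: mem_set.
  case: ifP => // wC /set_mem Sy; apply: mem_set => /=.
  by apply/andP; split => //; exact/asboolP.
have mC : measurable C := GW _ GC.
transitivity (Q [set w | S' (F w, Y w)]).
  congr (Q _); apply/seteqP; split => w /=.
    by move=> [Cw Sw]; apply/andP; split; [exact: mem_set|exact/asboolP].
  by move=> /andP[/set_mem ? /asboolP].
rewrite (probability_pair_section (P := P))//; last first.
  move=> A B mA mB; apply: indY => //.
  by rewrite -[X in <<s _ >> X]setTI; exact: mf.
have mPS : measurable_fun [set: W] (fun w => P (xsection S' (F w))).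
  by apply: (measurableT_comp (measurable_fun_xsection P mS')).
rewrite -(integral_cst Q mC q%:E) integral_mkcond.
apply: ae_eq_integral => //.
  by apply/(measurable_restrictT _ mC); exact: measurable_cst.
apply: filterS PSq => w PSw _; rewrite secS' patchE.
by case: ifP => // _; rewrite measure0.
Qed.

(** * The binomial law *)

Lemma measurable_count (d : measure_display) (W : measurableType d) (n : nat)
    (E : 'I_n -> set W) (p : pred 'I_n) :
  (forall i, p i -> measurable (E i)) ->
  forall m, measurable [set w | (\sum_(j < n | p j) (w \in E j))%N = m].
Proof.
move=> mE m.
suff mN : measurable_fun setT
    (fun w => (\sum_(j <- index_enum 'I_n | p j) (w \in E j))%N).
  by rewrite -[X in measurable X]setTI; exact: (mN measurableT [set m]).
elim: (index_enum _) => [|j s IH].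
  rewrite (_ : (fun w => _) = cst 0%N); first exact: measurable_cst.
  by apply/funext => w; rewrite big_nil.
have [pj|npj] := boolP (p j); last first.
  move: IH; congr measurable_fun; apply/funext => w.
  by rewrite big_cons (negbTE npj).
rewrite (_ : (fun w => _) =
    (fun w => ((w \in E j) + \sum_(j <- s | p j) (w \in E j))%N)); last first.
  by apply/funext => w; rewrite big_cons pj.
apply: measurable_fun_addn => //.
apply: (@measurableT_comp _ _ _ _ _ _ nat_of_bool) => //.
apply: (measurable_fun_bool true).
rewrite setTI (_ : _ @^-1` _ = E j); first exact: mE.
by apply/seteqP; split => w /= => [/set_mem|/mem_set].
Qed.

Lemma binomial_pmfS0 (R : realType) (k : nat) (q : R) :
  binomial_pmf k.+1 q 0 = (1 - q) * binomial_pmf k q 0.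
Proof. by rewrite /binomial_pmf !subn0 !bin0 !mulr1n !expr0 !mul1r exprS. Qed.

Lemma binomial_pmfSS (R : realType) (k i : nat) (q : R) :
  binomial_pmf k.+1 q i.+1
  = (1 - q) * binomial_pmf k q i.+1 + q * binomial_pmf k q i.
Proof.
rewrite /binomial_pmf binS mulrnDr subSS; congr (_ + _); last first.
  by rewrite exprS -mulrA mulrnAr.
have [ki|ik] := leqP k i; first by rewrite bin_small ?ltnS// !mulr0n mulr0.
rewrite mulrnAr; congr (_ *+ _).
by rewrite mulrCA -exprS subnSK.
Qed.

(** Instead of mutual independence of the events, it suffices that each has
    conditional probability [q] given the number of earlier ones that occurred:
    the law of that number then obeys Pascal's recursion. *)
Lemma count_binomial (R : realType) (d : measure_display)
    (W : measurableType d) (Q : probability W R) (n : nat)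
    (E : 'I_n -> set W) (q : R) :
  (forall i, measurable (E i)) ->
  (forall (k : 'I_n) (i : nat),
     Q ([set w | (\sum_(j < n | (j < k)%N) (w \in E j))%N = i] `&` E k)
     = (q%:E * Q [set w | (\sum_(j < n | (j < k)%N) (w \in E j))%N = i])%E) ->
  forall i, Q [set w | (\sum_(j < n) (w \in E j))%N = i]
    = (binomial_pmf n q i)%:E.
Proof.
move=> mE.
set N := fun (k : nat) w => (\sum_(j < n | (j < k)%N) (w \in E j))%N.
rewrite -/N => step.
have NS (k : 'I_n) w : N k.+1 w = ((w \in E k) + N k w)%N.
  rewrite /N (bigD1 k)//=; congr (_ + _)%N; apply: eq_bigl => j.
  by rewrite ltnS ltn_neqAle andbC.
have N0 w : N 0%N w = 0%N by rewrite /N big1.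
have mN k i : measurable [set w | N k w = i] by exact: measurable_count.
suff law k : (k <= n)%N -> forall i, Q [set w | N k w = i] = (binomial_pmf k q i)%:E.
  move=> i; rewrite -law//; congr (Q _); apply/seteqP.
  by rewrite /N; split => w /= <-; apply: eq_bigl => j; rewrite ltn_ord.
elim: k => [_ i|k IH kn i].
  rewrite /binomial_pmf bin0n sub0n expr0 mulr1.
  case: i => [|i]; last by rewrite (_ : [set w | _] = set0) ?measure0//;
    apply/seteqP; split => // w /=; rewrite N0.
  rewrite mulr1n (_ : [set w | _] = setT) ?probability_setT//.
  by apply/seteqP; split => // w /=; rewrite N0.
have {}IH := IH (ltnW kn).
pose k' : 'I_n := Ordinal kn.
have {}step j : Q ([set w | N k w = j] `&` E k') =
  (q%:E * Q [set w | N k w = j])%E := step k' j.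
have {}NS w : N k.+1 w = ((w \in E k') + N k w)%N := NS k' w.
have QD j : Q ([set w | N k w = j] `\` E k') = ((1 - q) * binomial_pmf k q j)%:E.
  have -> : Q ([set w | N k w = j] `\` E k') =
      (Q [set w | N k w = j] - Q ([set w | N k w = j] `&` E k'))%E.
    by apply: measureD => //; rewrite -ge0_fin_numE// fin_num_measure.
  by rewrite step IH -EFinM -EFinB mulrBl mul1r.
case: i => [|i].
  rewrite binomial_pmfS0 -QD; congr (Q _); apply/seteqP; split => w /=; rewrite NS.
    by case: (boolP (w \in E k')) => // + Nw; rewrite notin_setE.
  by move=> [-> Ew]; case: (boolP (w \in E k')) => // /set_mem.
rewrite binomial_pmfSS EFinD -QD EFinM -IH -step -measureU//.
- congr (Q _); apply/seteqP; split => w /=; rewrite NS.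
    case: (boolP (w \in E k')) => [/set_mem ? [Nw]|]; first by right.
    by rewrite notin_setE add0n => ? ?; left.
  move=> [[-> Ew]|[-> Ew]]; case: (boolP (w \in E k')) => //.
    by move=> /set_mem.
  by move=> /negP[]; exact: mem_set.
- by apply: measurableD.
- by apply: measurableI.
- by apply/seteqP; split => // w /= [[_ ?] [_ ?]].
Qed.

Lemma count_lt_binomial (R : realType) (d : measure_display)
    (W : measurableType d) (Q : probability W R) (n : nat)
    (E : 'I_n -> set W) (q : R) :
  (forall i, measurable (E i)) ->
  (forall (k : 'I_n) (i : nat),
     Q ([set w | (\sum_(j < n | (j < k)%N) (w \in E j))%N = i] `&` E k)
     = (q%:E * Q [set w | (\sum_(j < n | (j < k)%N) (w \in E j))%N = i])%E) ->
  forall r, measurable [set w | (\sum_(j < n) (w \in E j) < r)%N] /\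
    Q [set w | (\sum_(j < n) (w \in E j) < r)%N]
    = (\sum_(k < r) binomial_pmf n q k)%:E.
Proof.
move=> mE step; elim=> [|r [mr Qr]].
  rewrite (_ : [set w | _] = set0) ?big_ord0 ?measure0//.
  by apply/seteqP; split.
have mN : measurable [set w | (\sum_(j < n) (w \in E j))%N = r].
  exact: measurable_count.
have -> : [set w | (\sum_(j < n) (w \in E j) < r.+1)%N] =
    [set w | (\sum_(j < n) (w \in E j) < r)%N] `|`
    [set w | (\sum_(j < n) (w \in E j))%N = r].
  apply/seteqP; split => w /=.
    by rewrite ltnS leq_eqVlt => /orP[/eqP|]; [right|left].
  by move=> [/ltnW|<-]; rewrite ltnS.
split; first exact: measurableU.
rewrite measureU//; last first.
  by apply/seteqP; split => // w /= [+ Nr]; rewrite Nr ltnn.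
rewrite big_ord_recr/= EFinD -Qr; congr (_ + _)%E.
exact: count_binomial.
Qed.

(** * Calibration of the uncertainty set *)

Lemma measurable_mktuple (d d' : measure_display) (W : measurableType d)
    (T : measurableType d') (n : nat) (X : 'I_n -> W -> T) :
  (forall i, measurable_fun setT (X i)) ->
  measurable_fun setT (fun w => [tuple X i w | i < n]).
Proof.
move=> mX; apply/measurable_fun_tnthP => i.
move: (mX i); congr measurable_fun.
by apply/funext => w /=; rewrite tnth_mktuple.
Qed.

Section calibration.
Context (R : realType) (m n1 n2 : nat) (dW : measure_display).
Context (W : measurableType dW) (PD : probability W R).
Context (P : probability (m.-tuple R) R).
Context (xi : 'I_n1 + 'I_n2 -> {RV PD >-> m.-tuple R}).
Context (eps : R) (t : n1.-tuple (m.-tuple R) -> {RV P >-> R}).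
Context (eps01 : 0 < eps < 1).
Context (xi_iid : iid P xi).
Context (t_meas : measurable_fun
  [set: n1.-tuple (m.-tuple R) * m.-tuple R] (fun p => t p.1 p.2)).
Context (t_cont : {ae PD, forall w, continuous (cdf (t (data1 xi w)))}).

(** Scores below the [1 - eps] quantile of the score function built from the
    first component.  Comparing levels of the distribution function, rather than
    scores with a quantile, avoids choosing among several quantiles and gives a
    set that is measurable jointly in the data and the new point. *)
Definition low_score : set (n1.-tuple (m.-tuple R) * m.-tuple R) :=
  [set u | (cdf (t u.1) (t u.1 u.2) < (1 - eps)%:E)%E].

Definition low_draw (j : 'I_n2) : set W :=
  [set w | low_score (data1 xi w, xi (inr j) w)].

Lemma measurable_low_score : measurable low_score.
Proof.
pose V := ((n1.-tuple (m.-tuple R) * m.-tuple R) * m.-tuple R)%type.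
(* The section of H at (a, y) is the event whose probability is the value at
   t a y of the distribution function of t a. *)
pose H : set V := [set v | t v.1.1 v.2 <= t v.1.1 v.1.2].
have mH : measurable H.
  have m1 : measurable_fun setT (fun v : V => t v.1.1 v.2).
    apply: (measurableT_comp t_meas (g := fun v : V => (v.1.1, v.2))).
    apply: measurable_fun_pair => //.
    exact: (measurableT_comp measurable_fst measurable_fst).
  have m2 : measurable_fun setT (fun v : V => t v.1.1 v.1.2).
    exact: (measurableT_comp t_meas measurable_fst).
  have mle : measurable_fun setT (fun v : V => t v.1.1 v.2 <= t v.1.1 v.1.2).
    exact: measurable_fun_ler.
  by rewrite -[H]setTI; exact: (mle measurableT [set true]).
have mF := measurable_fun_xsection P mH.
have -> : low_score = [set u | (P (xsection H u) < (1 - eps)%:E)%E].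
  apply/seteqP; split => -[a y] /=; rewrite /low_score /= cdf_sublevel => Hlt.
    rewrite (_ : xsection _ _ = [set z | t a z <= t a y])//.
    by apply/seteqP; split => z /= => [/set_mem|?]//; exact: mem_set.
  rewrite (_ : [set z | t a z <= t a y] = xsection H (a, y))//.
  by apply/seteqP; split => z /= => [?|/set_mem]//; exact: mem_set.
have := mF measurableT _ (emeasurable_itv `]-oo, (1 - eps)%:E[).
by rewrite setTI; congr measurable; apply/seteqP; split => y /=; rewrite in_itv.
Qed.

Lemma measurable_low_draw (d : measure_display) (W' : measurableType d)
    (X : 'I_n1 + 'I_n2 -> W' -> m.-tuple R) (j : 'I_n2) :
  (forall i, measurable_fun setT (X (inl i))) ->
  measurable_fun setT (X (inr j)) ->
  measurable [set w | low_score ([tuple X (inl i) w | i < n1], X (inr j) w)].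
Proof.
move=> mX mXj; rewrite -[X in measurable X]setTI.
apply: (measurable_fun_pair (measurable_mktuple mX) mXj) => //.
exact: measurable_low_score.
Qed.

(** For almost every first data set the score is a continuous random variable,
    so each draw of the second data set is low with probability exactly
    [1 - eps], independently of everything drawn before it. *)
Lemma low_draw_fresh (k : 'I_n2) (i : nat) :
  PD ([set w | (\sum_(j < n2 | (j < k)%N) (w \in low_draw j))%N = i]
        `&` low_draw k)
  = ((1 - eps)%:E *
     PD [set w | (\sum_(j < n2 | (j < k)%N) (w \in low_draw j))%N = i])%E.
Proof.
have [indep sameP] := xi_iid.
have mX j : j != inr k -> measurable_fun
    [set: g_sigma_algebraType (cylinders_off measurable xi (inr k))] (xi j).
  exact: measurable_fun_off.
have mD1 : measurable_fun
    [set: g_sigma_algebraType (cylinders_off measurable xi (inr k))] (data1 xi).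
  apply: (@measurable_mktuple _ _
    (g_sigma_algebraType (cylinders_off measurable xi (inr k))) _ n1
    (fun j w => xi (inl j) w)) => j.
  exact: mX.
apply: (@probability_fresh_section _ _ _ _ W _ _ PD P (xi (inr k))
  (cylinders_off measurable xi (inr k)) _ (data1 xi) low_score).
- exact: cylinders_off_measurable.
- move=> A B GA mB; rewrite mutually_independent_sigma_off//.
  by rewrite -(sameP (inr k) B mB).
- exact: mD1.
- apply: (@measurable_count _
    (g_sigma_algebraType (cylinders_off measurable xi (inr k)))) => j jk.
  apply: (@measurable_low_draw _
    (g_sigma_algebraType (cylinders_off measurable xi (inr k)))
    (fun j w => xi j w)).
    by move=> i0; exact: mX.
  by apply: mX; apply: contraTneq jk => -[->]; rewrite ltnn.
- exact: measurable_low_score.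
- apply: filterS t_cont => w /probability_cdf_lt <-; last first.
    by move: eps01 => /andP[? ?]; rewrite subr_gt0 ltrBlDr ltrDl; apply/andP.
  by congr (P _); apply/seteqP; split => y /= => [/set_mem|?]//; exact: mem_set.
Qed.

End calibration.

(** The coverage of the uncertainty set is the distribution function of the
    score evaluated at the threshold; it is too small exactly when the
    [istar]-th ranked score is low, that is when at least [istar] draws are. *)
Lemma uncertainty_set_coverage (R : realType) (m n1 n2 : nat)
    (P : probability (m.-tuple R) R) (eps delta : R)
    (t : n1.-tuple (m.-tuple R) -> {RV P >-> R})
    (D1 : n1.-tuple (m.-tuple R)) (D2 : n2.-tuple (m.-tuple R)) :
  (0 < istar eps delta n2 <= n2)%N ->
  ((1 - eps)%:E <= P (uncertainty_set eps delta t D1 D2))%E =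
  (\sum_(j < n2) ((D1, tnth D2 j) \in low_score eps t) < istar eps delta n2)%N.
Proof.
move=> r_bounds.
pose p x := (cdf (t D1) x < (1 - eps)%:E)%E.
have pdown x y : x <= y -> p y -> p x.
  by move=> xy; apply: le_lt_trans; exact: cdf_nondecreasing.
rewrite -cdf_sublevel leNgt ltnNge; congr (~~ _).
rewrite -/(p _) (order_statistic_count pdown) ?size_map ?size_tuple//.
congr (_ <= _)%N.
rewrite count_map -sum1_count big_tuple big_mkcond/=.
apply: eq_bigr => j _.
have -> : ((D1, tnth D2 j) \in low_score eps t) = p (t D1 (tnth D2 j)).
  by apply/idP/idP => [/set_mem|?]//; exact: mem_set.
by case: (p _).
Qed.

Theorem theorem1 (R : realType) (m n1 n2 : nat)
    (dW : measure_display) (W : measurableType dW) (PD : probability W R)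
    (P : probability (m.-tuple R) R)
    (xi : 'I_n1 + 'I_n2 -> {RV PD >-> m.-tuple R})
    (eps delta : R)
    (t : n1.-tuple (m.-tuple R) -> {RV P >-> R})
    (eps01 : 0 < eps < 1) (delta01 : 0 < delta < 1)
    (Pcont : continuous_distribution P)
    (xi_iid : iid P xi)
    (n2_large : ln delta / ln (1 - eps) <= n2%:R)
    (t_meas : measurable_fun [set: n1.-tuple (m.-tuple R) * m.-tuple R]
                (fun p => t p.1 p.2))
    (t_cont : {ae PD, forall w, continuous (cdf (t (data1 xi w)))}) :
  let U := fun w => uncertainty_set eps delta t (data1 xi w) (data2 xi w) in
  ((1 - delta)%:E <= PD [set w | ((1 - eps)%:E <= P (U w))%E])%E
  /\
  forall (d : nat) (V : Type) (A : set V)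
    (f : d.-tuple R -> R) (g : d.-tuple R -> m.-tuple R -> V)
    (xhat : n1.-tuple (m.-tuple R) -> n2.-tuple (m.-tuple R) -> d.-tuple R),
    let E := [set w |
      chance_feasible P eps g A (xhat (data1 xi w) (data2 xi w))] in
    (forall x, measurable [set y | A (g x y)]) ->
    measurable E ->
    {ae PD, forall w,
      robust_optimal f g A (U w) (xhat (data1 xi w) (data2 xi w))} ->
    ((1 - delta)%:E <= PD E)%E.
Proof.
have [r_bounds r_level] := istarP eps01 delta01 n2_large.
move=> U.
pose E := low_draw xi eps t.
have mE j : measurable (E j).
  exact: (@measurable_low_draw _ _ _ _ _ eps t t_meas _ W (fun i w => xi i w)).
have [mcov covP] := count_lt_binomial mE
  (low_draw_fresh eps01 xi_iid t_meas t_cont) (istar eps delta n2).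
have coverE : [set w | ((1 - eps)%:E <= P (U w))%E] =
    [set w | (\sum_(j < n2) (w \in E j) < istar eps delta n2)%N].
  have countE w : (\sum_(j < n2)
      ((data1 xi w, tnth (data2 xi w) j) \in low_score eps t) =
      \sum_(j < n2) (w \in E j))%N.
    by apply: eq_bigr => j _; rewrite tnth_mktuple.
  by apply/seteqP; split => w /=; rewrite uncertainty_set_coverage// countE.
have coverage : ((1 - delta)%:E <= PD [set w | ((1 - eps)%:E <= P (U w))%E])%E.
  rewrite coverE covP lee_fin (le_trans r_level)// le_eqVlt; apply/orP; left.
  apply/eqP; apply: eq_bigr => k _.
  rewrite -mulrA mulr_natl; congr (_ * _ ^+ _ *+ _).
  exact/esym/subKr.
split=> // d V A f g xhat E' mg mE' [B [mB PDB0 optB]].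
(* Outside the null set B the solution is robust feasible, so the coverage of
   the uncertainty set is a lower bound for the probability of feasibility. *)
apply: (le_trans coverage).
apply: (@le_trans _ _ (PD (E' `|` B))); last first.
  by rewrite -[leRHS]adde0 -PDB0; exact: measureU2.
apply: le_measure; rewrite ?inE ?coverE//; first exact: measurableU.
rewrite -coverE => w /= Uw.
have [Bw|nBw] := pselect (B w); [by right|left].
have [feas _] : robust_optimal f g A (U w) (xhat (data1 xi w) (data2 xi w)).
  by apply: contrapT => nopt; apply: nBw; exact: optB.
apply: (le_trans Uw); apply: le_measure; rewrite ?inE//.
exact: measurable_sublevel.
Qed.
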